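(* Let $n \ge 1$ be an integer. The DDG corresponding to the algorithm $\textsf{optimal\_uniform}(n)$ is an optimal DDG for the uniform distribution on $\{1, \ldots, n\}$. Here $\textsf{optimal\_uniform}(n)$ is: (1) set $m \leftarrow 1$, $X \leftarrow 1$; (2) while $m < n$: (3) flip a fair coin $B \in \{0,1\}$; (4) set $X \leftarrow X + Bm$, $m \leftarrow 2m$; (5) if $m \ge n$ and $X \le n$ then $m \leftarrow n$; (6) if $m \ge n$ and $X > n$ then $X \leftarrow X - n$, $m \leftarrow m - n$; (7) return $X$.
   Context: A discrete distribution generating tree (DDG) is a rooted binary tree (possibly infinite) whose leaves are each labeled by an outcome; sampling proceeds from the root by flipping a fair coin at each internal node (0 = left child, 1 = right child) until a leaf is reached, whose label is output. Any algorithm that reads fair coin flips one at a time and eventually outputs a value corresponds to such a DDG (the node reached after a sequence of flips records the flips so far; leaves are the flip sequences at which the algorithm outputs). For a DDG $T$ let $N(T)$ be the random number of flips used. A DDG $T$ with output distribution $p$ is optimal for $p$ if for every DDG $T'$ with output distribution $p$ and every $i \ge 0$, $\mathbb{P}(N(T) > i) \le \mathbb{P}(N(T') > i)$. *)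

(* Defs.v *)
From HB Require Import structures.
From mathcomp Require Import all_boot all_order all_algebra.
From mathcomp Require Import all_classical all_reals all_analysis.

Set Implicit Arguments.
Unset Strict Implicit.
Unset Printing Implicit Defensive.

Import Order.TTheory GRing.Theory Num.Theory.

Local Open Scope classical_set_scope.
Local Open Scope ring_scope.

(* Coinductive, hence possibly infinite. In [Node l r], flipping 0 (false)
   leads to [l] and flipping 1 (true) leads to [r]. *)
CoInductive ddg (A : Type) : Type :=
| Leaf of A
| Node of ddg A & ddg A.

Definition leaf_label (A : Type) (T : ddg A) : option A :=
  if T is Leaf a then Some a else None.

Definition child (A : Type) (T : ddg A) (b : bool) : ddg A :=
  match T with
  | Leaf a => Leaf a
  | Node l r => if b then r else l
  end.

(* The subtree at which sampling stands when it has been allowed [k] flips,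
   with results [f 0, ..., f k.-1]; flips are ignored once at a leaf. *)
Fixpoint reached (A : Type) (T : ddg A) (f : nat -> bool) (k : nat) : ddg A :=
  if k is k'.+1 then child (reached T f k') (f k') else T.

Definition ddg_outputs (A : Type) (T : ddg A) (f : nat -> bool) (a : A) : Prop :=
  exists k, leaf_label (reached T f k) = Some a.

(* N(T), as a function of the flips: the first time a leaf is reached,
   +oo (the infimum of the empty set) if this never happens. *)
Definition flips_used (R : realType) (A : Type) (T : ddg A) (f : nat -> bool) :
    \bar R :=
  ereal_inf [set k%:R%:E | k in [set k | isSome (leaf_label (reached T f k))]].

(* The coins are mutually independent and each of them is fair. *)
Definition fair_coin_flips (R : realType) (d : measure_display)
    (Omega : measurableType d) (P : probability Omega R)
    (B : nat -> {mfun Omega >-> bool}) : Prop :=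
  (forall i b, P [set w | B i w = b] = (2^-1)%:E) /\
  (forall (I : seq nat) (b : nat -> bool), uniq I ->
     P [set w | forall i, i \in I -> B i w = b i] =
     (\prod_(i <- I) P [set w | B i w = b i])%E).

Definition has_output_distribution (R : realType) (d : measure_display)
    (Omega : measurableType d) (P : probability Omega R)
    (B : nat -> {mfun Omega >-> bool}) (A : Type) (T : ddg A) (p : A -> R) :
    Prop :=
  forall a, P [set w | ddg_outputs T (fun i => B i w) a] = (p a)%:E.

Definition optimal_ddg (R : realType) (d : measure_display)
    (Omega : measurableType d) (P : probability Omega R)
    (B : nat -> {mfun Omega >-> bool}) (A : Type) (T : ddg A) (p : A -> R) :
    Prop :=
  has_output_distribution P B T p /\
  forall T' : ddg A, has_output_distribution P B T' p -> forall i : nat,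
    (P [set w | i%:R%:E < flips_used R T (fun j => B j w)] <=
     P [set w | i%:R%:E < flips_used R T' (fun j => B j w)])%E.

(* An algorithm reading fair flips one at a time: in state [s] it returns [a]
   if [result s = Some a], and otherwise flips a coin [b] and goes to
   [step s b]. *)
Record coin_algorithm (A : Type) := CoinAlgorithm {
  state : Type;
  init : state;
  result : state -> option A;
  step : state -> bool -> state
}.

CoFixpoint ddg_from (A : Type) (alg : coin_algorithm A) (s : state alg) :
    ddg A :=
  match result s with
  | Some a => Leaf a
  | None => Node (ddg_from (step s false)) (ddg_from (step s true))
  end.

Definition ddg_of (A : Type) (alg : coin_algorithm A) : ddg A :=
  ddg_from (init alg).

(* A state is the pair (m, X). The subtractions are only performed when
   [n <= m] and [n < X], so their truncation is harmless. *)
Definition ou_double (s : nat * nat) (b : bool) : nat * nat :=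
  let: (m, X) := s in (2 * m, X + b * m)%N.

Definition ou_accept (n : nat) (s : nat * nat) : nat * nat :=
  let: (m, X) := s in
  if (n <= m)%N && (X <= n)%N then (n, X) else (m, X).

Definition ou_recycle (n : nat) (s : nat * nat) : nat * nat :=
  let: (m, X) := s in
  if (n <= m)%N && (n < X)%N then (m - n, X - n)%N else (m, X).

Definition optimal_uniform (n : nat) : coin_algorithm nat := {|
  state := (nat * nat)%type;
  init := (1, 1)%N;
  result := fun s => let: (m, X) := s in if (m < n)%N then None else Some X;
  step := fun s b => ou_recycle n (ou_accept n (ou_double s b))
|}.

(* The uniform distribution on {1, ..., n}, as a mass function on nat. *)
Definition uniform_pmf (R : realType) (n : nat) (x : nat) : R :=
  if (1 <= x <= n)%N then n%:R^-1 else 0.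

(* Main.v *)
Require Import Defs.
From mathcomp Require Import all_boot all_order all_algebra.
From mathcomp Require Import zify lra.
From mathcomp Require Import all_classical all_reals all_analysis.

(* The state (m, X) reached after k flips, over all 2 ^ k flip sequences, takes
   each value (2 ^ k mod n, X) with 1 <= X <= 2 ^ k mod n exactly once, and
   every outcome a in {1, ..., n} has been output by exactly 2 ^ k div n of the
   sequences. So P(output = a) lies within n / 2 ^ k of 1 / n for every k, and
   P(N > k) = (2 ^ k mod n) / 2 ^ k. In any other tree for the uniform
   distribution, an outcome is output within k flips by an integer number c of
   the 2 ^ k sequences, and c / 2 ^ k <= 1 / n forces c <= 2 ^ k div n, so at
   least 2 ^ k mod n sequences are not yet at a leaf. *)

Set Implicit Arguments.
Unset Strict Implicit.
Unset Printing Implicit Defensive.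
Import Order.TTheory GRing.Theory Num.Theory.

(** * Trees, flip prefixes and unfolding of algorithms *)

Section Trees.
Variable A : Type.
Implicit Types (T : ddg A) (f g : nat -> bool) (k : nat).

Lemma eq_reached T f g k :
  (forall i, (i < k)%N -> f i = g i) -> reached T f k = reached T g k.
Proof.
elim: k => //= k IHk fg; rewrite IHk => [|i ik]; last by rewrite fg// ltnW.
by rewrite fg.
Qed.

Lemma leaf_label_reached_stable T f k l a :
  (k <= l)%N -> leaf_label (reached T f k) = Some a ->
  leaf_label (reached T f l) = Some a.
Proof.
move=> /subnK <-; elim: (l - k)%N => //= m IHm /IHm {IHm}.
by case: (reached T f (m + k)).
Qed.

Lemma ddg_fromE (alg : coin_algorithm A) (s : state alg) :
  ddg_from s = if result s is Some a then Leaf a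
               else Node (ddg_from (step s false)) (ddg_from (step s true)).
Proof.
(* A cofixpoint reduces only under a [match], so the eta expansion forces one unfolding of
   [ddg_from]. *)
have ddg_eta T : T = match T with Leaf a => Leaf a | Node l r => Node l r end.
  by case: T.
by rewrite [LHS]ddg_eta /=; case: (result s).
Qed.

Lemma leaf_label_ddg_from (alg : coin_algorithm A) (s : state alg) :
  leaf_label (ddg_from s) = result s.
Proof. by rewrite ddg_fromE; case: (result s). Qed.

End Trees.

Lemma big_rcons_tuple (A : finType) (k : nat) (F : k.+1.-tuple A -> nat) :
  (\sum_(t : k.+1.-tuple A) F t =
   \sum_(t : k.-tuple A) \sum_(x : A) F [tuple of rcons t x])%N.
Proof.
pose rc (p : k.-tuple A * A) := [tuple of rcons p.1 p.2].
rewrite pair_big (reindex rc)//; apply/onW_bij/inj_card_bij.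
  by move=> [t x] [u y] /(congr1 val)/= /rcons_inj[/val_inj-> ->].
by rewrite card_prod !card_tuple expnSr.
Qed.

(** [reached] performs the flip of largest index last, so prefixes are extended on the right, with
    [rcons]. *)
Lemma sum_reachedS (A : Type) (T : ddg A) (F : ddg A -> nat) k :
  (\sum_(t : k.+1.-tuple bool) F (reached T (nth false t) k.+1) =
   \sum_(t : k.-tuple bool) \sum_(b : bool)
     F (child (reached T (nth false t) k) b))%N.
Proof.
rewrite big_rcons_tuple; apply: eq_bigr => t _; apply: eq_bigr => b _ /=.
rewrite nth_rcons size_tuple ltnn eqxx (@eq_reached _ _ _ (nth false t))// => i ik.
by rewrite nth_rcons size_tuple ik.
Qed.

(** * Counting flip sequences by the state or label reached *)

Section Counting.
Variable n : nat.
Hypothesis n_gt0 : (0 < n)%N.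

Local Notation alg := (optimal_uniform n).

(** Doubling sends the pairs [(X, b)] bijectively onto the values [Y = X + b * m] in 1..2m. If
    [2 * m < n], nothing else happens; otherwise [Y <= n] is accepted and [Y > n] is recycled to
    [Y - n], which fills 1..2m-n. As [m < n], the quotient of [2 * m] by [n] is 0 or 1, which covers
    both cases. *)
Lemma sum_step_optimal_uniform (F : nat * nat -> nat) m : (0 < m < n)%N ->
  (\sum_(1 <= X < m.+1) \sum_(b : bool) F (step (c := alg) (m, X) b) =
   \sum_(1 <= X < ((2 * m) %% n).+1) F ((2 * m) %% n, X)%N +
   ((2 * m) %/ n) * \sum_(1 <= X < n.+1) F (n, X))%N.
Proof.
move=> /andP[m_gt0 ltmn].
pose G Y := F (ou_recycle n (ou_accept n (2 * m, Y)%N)).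
have -> :
    (\sum_(1 <= X < m.+1) \sum_(b : bool) F (step (c := alg) (m, X) b) =
     \sum_(1 <= Y < (2 * m).+1) G Y)%N.
  (* The values up to [m] come from flip 0, those above [m] from flip 1. *)
  rewrite [RHS](@big_cat_nat _ _ _ m.+1) /=; [|lia..].
  have -> : (\sum_(m.+1 <= Y < (2 * m).+1) G Y =
             \sum_(1 <= X < m.+1) G (X + m))%N.
    by rewrite -[m.+1]add1n big_addn; congr (bigop _ (index_iota _ _) _); lia.
  rewrite -big_split /=.
  by apply: eq_bigr => X _; rewrite big_bool /= mul1n mul0n addn0 addnC.
have [lt2mn|le_n_2m] := ltnP (2 * m) n.
  rewrite modn_small// divn_small// mul0n addn0.
  by apply: eq_bigr => Y _; rewrite /G /= leqNgt lt2mn /= leqNgt lt2mn.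
have -> : (2 * m %/ n = 1)%N.
  rewrite -[(2 * m)%N](subnK le_n_2m) divnDr ?divnn// n_gt0 divn_small//; lia.
have -> : (2 * m %% n = 2 * m - n)%N.
  rewrite -{1}[(2 * m)%N](subnK le_n_2m) modnDr modn_small//; lia.
rewrite mul1n [LHS](@big_cat_nat _ _ _ n.+1) /=; [|lia..].
rewrite addnC; congr addn; last first.
  apply: eq_big_nat => Y /andP[_]; rewrite ltnS => leYn.
  by rewrite /G /= le_n_2m leYn /= leqnn /= ltnNge leYn.
rewrite -[X in \sum_(X <= _ < _) _]add1n big_addn subSn//.
apply: eq_big_nat => Y /andP[Y_gt0 _].
have ltnYn : (n < Y + n)%N by lia.
by rewrite /G /= le_n_2m /= leqNgt ltnYn /= le_n_2m ltnYn /= addnK.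
Qed.

Lemma child_optimal_uniform m X b : (m < n)%N ->
  child (ddg_from (alg := alg) (m, X)) b =
  ddg_from (alg := alg) (step (c := alg) (m, X) b).
Proof. by move=> ltmn; rewrite [in LHS]ddg_fromE /= ltmn; case: b. Qed.

Lemma ddg_from_done X : ddg_from (alg := alg) (n, X) = Leaf X.
Proof. by rewrite ddg_fromE /= ltnn. Qed.

(** [F] is arbitrary so that the induction hypothesis can be applied to the sum of [F] over both
    children. Each finished sequence has two finished extensions, and the pending states evolve by
    [sum_step_optimal_uniform]. *)
Lemma sum_reached_optimal_uniform (F : ddg nat -> nat) k :
  (\sum_(t : k.-tuple bool) F (reached (ddg_of alg) (nth false t) k) =
   \sum_(1 <= X < (2 ^ k %% n).+1)
     F (ddg_from (alg := alg) (2 ^ k %% n, X)) +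
   (2 ^ k %/ n) * \sum_(1 <= a < n.+1) F (Leaf a))%N.
Proof.
elim: k F => [F|k IHk F].
  rewrite expn0 (big_pred1 [tuple]) => [|t]; last by rewrite [t]tuple0 /= eqxx.
  (* For [n = 1] the initial state is already a leaf and [1 %% n] is 0; otherwise it is the one
     pending state. *)
  have [n1|n1] := eqVneq n 1%N.
    have /= -> : ddg_of alg = Leaf 1%N by rewrite -(ddg_from_done 1) n1.
    by rewrite n1 modnn divnn big_geq// add0n mul1n big_nat1.
  rewrite modn_small 1?divn_small ?mul0n ?addn0 ?big_nat1//; lia.
rewrite sum_reachedS (IHk (fun T => \sum_(b : bool) F (child T b)))%N.
set m := (2 ^ k %% n)%N; set q := (2 ^ k %/ n)%N.
have ltmn : (m < n)%N by rewrite ltn_mod.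
have E2 : (2 ^ k.+1 = q * 2 * n + 2 * m)%N.
  by rewrite expnS {1}(divn_eq (2 ^ k) n) -/q -/m; lia.
rewrite E2 modnMDl divnMDl// mulnDl.
have -> : (\sum_(1 <= a < n.+1) \sum_(b : bool) F (child (Leaf a) b) =
  2 * \sum_(1 <= a < n.+1) F (Leaf a))%N.
  by rewrite big_distrr; apply: eq_bigr => a _; rewrite big_bool /=; lia.
under [in LHS]eq_bigr do under eq_bigr do rewrite child_optimal_uniform//.
(* If [m = 0], no sequence is pending and only the leaves are duplicated. *)
have [m0|m_gt0] := posnP m.
  by rewrite m0 muln0 mod0n div0n !(@big_geq _ _ _ 1 1)// mulnA; lia.
rewrite (sum_step_optimal_uniform (fun s => F (ddg_from (alg := alg) s)));
  last by rewrite m_gt0.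
under [X in (_ + _ * X + _)%N]eq_bigr do rewrite ddg_from_done.
lia.
Qed.
End Counting.

(* The number of the 2 ^ k flip sequences that stand at a leaf labeled [a]
   after at most k flips, if [o = Some a], or at no leaf, if [o = None]. *)
Definition label_count (T : ddg nat) (k : nat) (o : option nat) : nat :=
  (\sum_(t : k.-tuple bool) (leaf_label (reached T (nth false t) k) == o))%N.

Lemma sum_eq_Some (n a : nat) :
  (\sum_(1 <= b < n.+1) (Some b == Some a) = (1 <= a <= n))%N.
Proof.
rewrite (eq_bigr (fun b => (b == a : nat))) // -big_mkcond /= sum1_count.
by rewrite count_uniq_mem ?iota_uniq// mem_index_iota.
Qed.

Lemma label_count_optimal_uniform_Some n k a : (0 < n)%N ->
  label_count (ddg_of (optimal_uniform n)) k (Some a) =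
  ((1 <= a <= n) * (2 ^ k %/ n))%N.
Proof.
move=> n_gt0; rewrite /label_count.
rewrite (sum_reached_optimal_uniform n_gt0 (fun T => leaf_label T == Some a)).
rewrite big1 => [|X _]; last by rewrite leaf_label_ddg_from /= ltn_mod n_gt0.
by rewrite sum_eq_Some add0n mulnC.
Qed.

Lemma label_count_optimal_uniform_None n k : (0 < n)%N ->
  label_count (ddg_of (optimal_uniform n)) k None = (2 ^ k %% n)%N.
Proof.
move=> n_gt0; rewrite /label_count.
rewrite (sum_reached_optimal_uniform n_gt0 (fun T => leaf_label T == None)).
rewrite [X in (_ + _ * X)%N]big1// muln0 addn0.
under eq_bigr do rewrite leaf_label_ddg_from /= ltn_mod n_gt0 eqxx.
by rewrite sum_nat_const_nat muln1 subn1.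
Qed.

(** Pigeonhole: each of the [2 ^ k] sequences is at no leaf or at a label in 1..n, and the latter
    kind number at most [n * (2 ^ k %/ n)]. *)
Lemma label_count_None_ge (T : ddg nat) n k : (0 < n)%N ->
  (forall a, label_count T k (Some a) <= (1 <= a <= n) * (2 ^ k %/ n))%N ->
  (2 ^ k %% n <= label_count T k None)%N.
Proof.
move=> n_gt0 leT.
suff le2k : (2 ^ k <= label_count T k None +
                \sum_(1 <= a < n.+1) label_count T k (Some a))%N.
  have : (\sum_(1 <= a < n.+1) label_count T k (Some a) <= n * (2 ^ k %/ n))%N.
    have -> : (n * (2 ^ k %/ n) = \sum_(1 <= a < n.+1) 2 ^ k %/ n)%N.
      by rewrite sum_nat_const_nat subn1.
    apply: leq_sum => a _; rewrite (leq_trans (leT a))//.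
    by case: (1 <= a <= n)%N; rewrite ?mul1n ?mul0n.
  by have := divn_eq (2 ^ k) n; lia.
rewrite /label_count exchange_big -big_split /=.
rewrite -[X in (X <= _)%N]muln1 -card_bool -card_tuple -sum_nat_const.
apply: leq_sum => t _.
case E: (leaf_label _) => [a|//]; rewrite add0n; under eq_bigr do rewrite eq_sym.
rewrite sum_eq_Some.
(* A label outside 1..n would have count at least 1, because of [t], against the bound 0. *)
have := leT a; rewrite /label_count (bigD1 t)//= E eqxx.
by case: (1 <= a <= n)%N.
Qed.

(** * From counts to probabilities *)

Section Probability.
Context (R : realType) (d : measure_display) (Omega : measurableType d).
Context (P : probability Omega R) (B : nat -> {mfun Omega >-> bool}).
Hypothesis hB : fair_coin_flips P B.
Local Open Scope classical_set_scope.
Local Open Scope ring_scope.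

Let flips (k : nat) (w : Omega) : k.-tuple bool := [tuple B i w | i < k].

Lemma nth_flips k w i : (i < k)%N -> nth false (flips k w) i = B i w.
Proof. by move=> ik; rewrite -[i]/(val (Ordinal ik)) -tnth_nth tnth_mktuple. Qed.

(** This is the form of event to which the independence clause of [fair_coin_flips] applies. *)
Lemma flips_eqE k (t : k.-tuple bool) :
  flips k @^-1` [set t] =
  [set w | forall i, i \in iota 0 k -> B i w = nth false t i].
Proof.
apply/seteqP; split => w /=.
  by move=> <- i; rewrite mem_iota /= add0n => ik; rewrite nth_flips.
move=> Bt; apply: eq_from_tnth => i; rewrite tnth_mktuple (tnth_nth false) Bt//.
by rewrite mem_iota add0n /=.
Qed.

Lemma measurable_flips_eq k (t : k.-tuple bool) :
  measurable (flips k @^-1` [set t]).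
Proof.
rewrite (_ : flips k @^-1` _ =
   \bigcap_(i in [set: 'I_k]) (B i @^-1` [set tnth t i])).
  by apply: fin_bigcap_measurable => // i _; exact: measurable_funPTI.
apply/seteqP; split => w /=; first by move=> <- i _ /=; rewrite tnth_mktuple.
by move=> wt; apply: eq_from_tnth => i; rewrite tnth_mktuple (wt i).
Qed.

Lemma probability_flips_eq k (t : k.-tuple bool) :
  P (flips k @^-1` [set t]) = ((2 ^+ k)^-1)%:E.
Proof.
rewrite flips_eqE (hB.2 _ _ (iota_uniq 0 k)).
rewrite (eq_bigr (fun=> (2^-1)%:E)) => [|i _]; last exact: hB.1.
by rewrite prodEFin big_const_seq count_predT size_iota iter_mulr_1 exprVn.
Qed.

Lemma measurable_flips k (Q : pred (k.-tuple bool)) :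
  measurable [set w | Q (flips k w)].
Proof.
rewrite (_ : mkset _ = \bigcup_(t in [set t | Q t]) flips k @^-1` [set t]).
  by apply: fin_bigcup_measurable => // t _; exact: measurable_flips_eq.
by apply/seteqP; split => w /= => [Qw|[t Qt ->//]]; exists (flips k w).
Qed.

Lemma probability_flips k (Q : pred (k.-tuple bool)) :
  P [set w | Q (flips k w)] =
  ((\sum_(t : k.-tuple bool) Q t)%N%:R / 2 ^+ k)%:E.
Proof.
rewrite (_ : mkset _ =
    \bigcup_(t in [set` [seq t <- enum {: k.-tuple bool} | Q t]])
      flips k @^-1` [set t]); last first.
  apply/seteqP; split => w /= => [Qw|[t /= + ->]].
    by exists (flips k w) => //=; rewrite mem_filter Qw mem_enum.
  by rewrite mem_filter => /andP[].
rewrite measure_fin_bigcup//; last by move=> *; exact: measurable_flips_eq.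
  rewrite -fsbig_seq; last by rewrite filter_uniq ?enum_uniq.
  rewrite (eq_bigr (fun=> ((2 ^+ k)^-1)%:E)) => [|t _];
    last exact: probability_flips_eq.
  rewrite sumEFin big_const_seq count_predT size_filter iter_addr_0.
  congr (_%:E).
  rewrite -[LHS]mulr_natl; congr (_%:R * _).
  by rewrite -sum1_count big_mkcond /= big_enum.
by move=> t u _ _ [w [<- <-]].
Qed.

Lemma leaf_label_flipsE (T : ddg nat) k (o : option nat) :
  [set w | leaf_label (reached T (B ^~ w) k) = o] =
  [set w | leaf_label (reached T (nth false (flips k w)) k) == o].
Proof.
apply/seteqP; split => w /=; rewrite (@eq_reached _ _ (nth false _) (B ^~ w)).
- by move=> ->.
- exact: nth_flips.
- by move/eqP.
- exact: nth_flips.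
Qed.

Lemma measurable_leaf_label (T : ddg nat) k (o : option nat) :
  measurable [set w | leaf_label (reached T (B ^~ w) k) = o].
Proof.
rewrite leaf_label_flipsE.
exact: (@measurable_flips _ (fun t => leaf_label (reached T (nth false t) k) == o)).
Qed.

Lemma probability_leaf_label (T : ddg nat) k (o : option nat) :
  P [set w | leaf_label (reached T (B ^~ w) k) = o] =
  ((label_count T k o)%:R / 2 ^+ k)%:E.
Proof.
rewrite leaf_label_flipsE.
exact: (@probability_flips _ (fun t => leaf_label (reached T (nth false t) k) == o)).
Qed.

Lemma flips_used_gtE (T : ddg nat) i :
  [set w | (i%:R%:E < flips_used R T (B ^~ w))%E] =
  [set w | leaf_label (reached T (B ^~ w) i) = None].
Proof.
apply/seteqP; split => w /=.
  case E: (leaf_label _) => [a|//]; rewrite ltNge => /negP[].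
  by apply: ereal_inf_lbound; exists i => //=; rewrite E.
(* The bound [i.+1] keeps the inequality strict after passing to the infimum, including when no leaf
   is ever reached and the infimum is infinite. *)
move=> lab_i; apply: (@lt_le_trans _ _ i.+1%:R%:E).
  by rewrite lte_fin ltr_nat.
apply: le_ereal_inf_tmp => _ [k /= + <-]; rewrite lee_fin ler_nat.
case: (ltnP i k) => // le_ki; case E: (leaf_label _) => [a|//] _.
by rewrite (leaf_label_reached_stable le_ki E) in lab_i.
Qed.

Lemma measurable_ddg_outputs (T : ddg nat) a :
  measurable [set w | ddg_outputs T (B ^~ w) a].
Proof.
rewrite (_ : mkset _ =
    \bigcup_k [set w | leaf_label (reached T (B ^~ w) k) = Some a]).
  by apply: bigcup_measurable => k _; exact: measurable_leaf_label.
by apply/seteqP; split => w [k]; [exists k|move=> _; exists k].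
Qed.

Lemma probability_ddg_outputs_ge (T : ddg nat) k a :
  (((label_count T k (Some a))%:R / 2 ^+ k)%:E <=
   P [set w | ddg_outputs T (B ^~ w) a])%E.
Proof.
rewrite -probability_leaf_label; apply: le_measure; rewrite ?inE.
- exact: measurable_leaf_label.
- exact: measurable_ddg_outputs.
- by move=> w /= lab; exists k.
Qed.

(** A run that outputs [a] and is at a leaf after [k] flips must be at label [a], since leaves are
    never left. *)
Lemma probability_ddg_outputs_le (T : ddg nat) k a :
  (P [set w | ddg_outputs T (B ^~ w) a] <=
   (((label_count T k (Some a))%:R + (label_count T k None)%:R) / 2 ^+ k)%:E)%E.
Proof.
rewrite mulrDl EFinD -!probability_leaf_label.
apply: (le_trans _ (measureU2 _ (measurable_leaf_label _ _ _)
                                (measurable_leaf_label _ _ _))).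
apply: le_measure; rewrite ?inE.
- exact: measurable_ddg_outputs.
- by apply: measurableU; exact: measurable_leaf_label.
move=> w /= [l lab_l]; case E: (leaf_label _) => [b|]; [left|by right].
have [le_kl|le_lk] := leqP k l.
  by rewrite -lab_l (leaf_label_reached_stable le_kl E).
by rewrite -E (leaf_label_reached_stable (ltnW le_lk) lab_l).
Qed.

Variable n : nat.
Hypothesis n_gt0 : (0 < n)%N.

Lemma optimal_uniform_output_distribution :
  has_output_distribution P B (ddg_of (optimal_uniform n)) (uniform_pmf R n).
Proof.
move=> a; set T := ddg_of _; set pa := P _.
have n0 : (0 : R) < n%:R by rewrite ltr0n.
have expk0 k : (0 : R) < 2 ^+ k by rewrite exprn_gt0.
have [r paE] : exists r, pa = r%:E.
  exists (fine pa); rewrite fineK// fin_num_measure//.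
  exact: measurable_ddg_outputs.
have bound k : `|r - uniform_pmf R n a| <= n%:R / 2 ^+ k.
  have := probability_ddg_outputs_le T k a.
  have := probability_ddg_outputs_ge T k a.
  rewrite -/pa paE !lee_fin label_count_optimal_uniform_None//.
  rewrite label_count_optimal_uniform_Some// natrM ler_pdivlMr// ler_pdivrMr//.
  rewrite (ler_pdivlMr `|_|)//.
  rewrite (_ : `|_| * _ = `|r * 2 ^+ k - uniform_pmf R n a * 2 ^+ k|); last first.
    by rewrite -mulrBl normrM [X in _ = _ * X]gtr0_norm.
  have /(congr1 (GRing.natmul (1 : R))) := divn_eq (2 ^ k) n.
  rewrite natrX natrD natrM.
  have : ((2 ^ k %% n)%N%:R : R) <= n%:R by rewrite ler_nat ltnW// ltn_mod.
  have : (1 : R) <= n%:R by rewrite ler1n.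
  have : (0 : R) <= (2 ^ k %% n)%N%:R by rewrite ler0n.
  rewrite /uniform_pmf ler_norml.
  move: (2 ^+ k : R) ((2 ^ k %/ n)%N%:R : R) ((2 ^ k %% n)%N%:R : R) (n%:R : R) n0.
  move=> x q m N N0 m0 N1 mN xE; case: ifP => _ /=; last by lra.
  (* Here [x] is [2 ^ k], with quotient [q] and remainder [m] by [N]. Both [r * x] in [q, q + m] and
     [x / N] in [q, q + 1] hold, so their difference lies between -1 and [m], hence within [N] of
     0. *)
  have -> : N^-1 * x = q + m / N by rewrite xE mulrC mulrDl mulfK// gt_eqF.
  have : 0 <= m / N by rewrite divr_ge0// ltW.
  have : m / N <= 1 by rewrite ler_pdivrMr// mul1r.
  by move: (m / N) => u; lra.
rewrite paE; congr _%:E; apply/eqP; rewrite -subr_eq0 -normr_le0.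
apply/ler_addgt0Pr => e e0; rewrite add0r.
(* This [k] exceeds [n / e], and [2 ^ k > k], so [n / 2 ^ k] is below [e]. *)
pose k := Num.bound (n%:R / e).
apply: (le_trans (bound k)); rewrite ler_pdivrMr// mulrC -ler_pdivrMr//.
apply: ltW; apply: (lt_le_trans (archi_boundP _)); first by rewrite divr_ge0// ltW.
by rewrite -natrX ler_nat ltnW// ltn_expl.
Qed.

Lemma optimal_uniform_flips_used_le (T : ddg nat) i :
  has_output_distribution P B T (uniform_pmf R n) ->
  (P [set w | i%:R%:E < flips_used R (ddg_of (optimal_uniform n)) (B ^~ w)] <=
   P [set w | i%:R%:E < flips_used R T (B ^~ w)])%E.
Proof.
move=> hT; rewrite !flips_used_gtE !probability_leaf_label lee_fin.
rewrite ler_pM2r ?invr_gt0 ?exprn_gt0// ler_nat label_count_optimal_uniform_None//.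
apply: label_count_None_ge => // a.
have := probability_ddg_outputs_ge T i a.
rewrite hT lee_fin ler_pdivrMr ?exprn_gt0//.
(* Outside 1..n the mass is 0, which forces the count to be 0. *)
rewrite /uniform_pmf; case: ifP => _; last by rewrite mul0r lern0 mul0n leqn0.
(* Integrality of the count enters here: [c * n <= 2 ^ i] is equivalent to [c <= 2 ^ i %/ n]. *)
rewrite mul1n leq_divRL// ler_pdivlMl ?ltr0n//.
by rewrite -natrX -natrM ler_nat mulnC.
Qed.
End Probability.

Theorem theorem3 (R : realType) (d : measure_display)
    (Omega : measurableType d) (P : probability Omega R)
    (B : nat -> {mfun Omega >-> bool}) (hB : fair_coin_flips P B)
    (n : nat) (hn : (1 <= n)%N) :
  optimal_ddg P B (ddg_of (optimal_uniform n)) (uniform_pmf R n).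
Proof.
split; first exact: optimal_uniform_output_distribution.
by move=> T hT i; exact: optimal_uniform_flips_used_le.
Qed.
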